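(* Let $T$ be a Schreier transversal for a right ideal $I\leq\mathcal{A}=K[F]$, and let $\prec_T$ be an exposure order on $F$ such that $u\prec_T v$ for every $u\in T$ and $v\in F\setminus T$. Then $T_{I,\prec_T}=T$. In particular, every Schreier transversal for $I$ is the minimal Schreier transversal of $I$ with respect to some exposure order on $F$.
   Context: $K$ is a field, $F$ is a free group with finite basis $S$ (elements are identified with reduced words in $S\cup S^{-1}$), and $\mathcal{A}=K[F]$. For $T\subseteq F$, $\mathrm{Sp}_K(T)$ denotes the $K$-linear span of $T$ in $\mathcal{A}$. An exposure order on $F$ is a well-order $\prec$ on $F$ such that $u\preceq v$ whenever $u$ is a prefix of $v$. For distinct subsets $A,B\subseteq F$, write $A\prec_{\min}B$ if $\min(A\triangle B)\in A$, the minimum taken with respect to $\prec$; this is a total order on subsets of $F$. A Schreier transversal for a right ideal $I$ is a prefix-closed subset $T\subseteq F$ such that $\mathrm{Sp}_K(T)\cap I=\{0\}$ and every $I$-coset in $\mathcal{A}$ intersects $\mathrm{Sp}_K(T)$. For an exposure order $\prec$, the set of Schreier transversals for $I$ has a minimum with respect to $\prec_{\min}$, denoted $T_{I,\prec}$ and called the minimal Schreier transversal of $I$ with respect to $\prec$. *)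

(* Defs.v *)
From HB Require Import structures.
From mathcomp Require Import all_boot all_algebra.
From mathcomp Require Import finmap.
From mathcomp.multinomials Require Import monalg.
From mathcomp Require Import boolp classical_sets wochoice.

Set Implicit Arguments.
Unset Strict Implicit.
Unset Printing Implicit Defensive.

Import GRing.Theory.

Section ReducedWords.
Variable S : eqType.
Implicit Types (x y : S * bool) (u v w : seq (S * bool)).

(* (s, true) is the generator s and (s, false) its inverse. *)
Definition letter_inv x : S * bool := (x.1, ~~ x.2).

Definition reduced w : bool := sorted (fun x y => y != letter_inv x) w.

Definition push x w :=
  if w is y :: w' then if y == letter_inv x then w' else x :: w else [:: x].

(* Freely reduced form of u ++ v, when v is reduced. *)
Definition word_mul u v := foldr push v u.

Definition word_inv u := rev (map letter_inv u).

Lemma letter_invK : involutive letter_inv.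
Proof. by case=> s b; rewrite /letter_inv /= negbK. Qed.

Lemma push_reduced x w : reduced w -> reduced (push x w).
Proof.
case: w => [|y w] //= red_yw; case: eqP => [_|/eqP ne] /=; last by rewrite ne.
exact: path_sorted red_yw.
Qed.

Lemma pushK x w : reduced w -> push (letter_inv x) (push x w) = w.
Proof.
case: w => [|y w] /=; first by rewrite letter_invK eqxx.
case: eqP => [->|_] red_w; last by rewrite /= letter_invK eqxx.
by case: w red_w => [|z w] //= /andP[/negPf->].
Qed.

Lemma word_mul_reduced u v : reduced v -> reduced (word_mul u v).
Proof. by move=> red_v; elim: u => //= x u; apply: push_reduced. Qed.

Lemma word_mul_push x u v :
  reduced v -> word_mul (push x u) v = push x (word_mul u v).
Proof.
move=> red_v; case: u => [|y u] //=; case: eqP => [->|_] //=.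
by rewrite -[X in push X (push _ _)]letter_invK pushK // word_mul_reduced.
Qed.

Lemma word_mulA u v w :
  reduced w -> word_mul u (word_mul v w) = word_mul (word_mul u v) w.
Proof.
by move=> red_w; elim: u => //= x u ->; rewrite word_mul_push.
Qed.

Lemma word_mul0 u : reduced u -> word_mul u [::] = u.
Proof.
elim: u => //= x u IHu red_u; rewrite IHu; last exact: path_sorted red_u.
by case: u red_u {IHu} => [|y u] //= /andP[/negPf->].
Qed.

Lemma word_invK : involutive word_inv.
Proof. by move=> u; rewrite /word_inv map_rev revK (mapK letter_invK). Qed.

Lemma word_inv_reduced u : reduced u -> reduced (word_inv u).
Proof.
rewrite /reduced /word_inv rev_sorted sorted_map.
by apply: sub_sorted => x y /=; rewrite letter_invK eq_sym.
Qed.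

Lemma word_mulV u : word_mul (word_inv u) u = [::].
Proof.
elim: u => //= x u IHu.
by rewrite /word_inv /= rev_cons /word_mul foldr_rcons /= letter_invK eqxx.
Qed.

End ReducedWords.

Section FreeGroup.
Variable S : choiceType.

Record free_group : predArgType :=
  FreeGroup { fg_word :> seq (S * bool); _ : reduced fg_word }.

HB.instance Definition _ := [isSub for fg_word].
HB.instance Definition _ := [Choice of free_group by <:].

Implicit Types u v w : free_group.

Definition fg_one : free_group := FreeGroup (isT : @reduced S [::]).
Definition fg_mul u v : free_group :=
  FreeGroup (word_mul_reduced u (valP v)).
Definition fg_inv u : free_group := FreeGroup (word_inv_reduced (valP u)).

Lemma fg_mulA : associative fg_mul.
Proof. by move=> u v w; apply/val_inj/word_mulA/(valP w). Qed.

Lemma fg_mul1g : left_id fg_one fg_mul.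
Proof. by move=> u; apply/val_inj. Qed.

Lemma fg_mulg1 : right_id fg_one fg_mul.
Proof. by move=> u; apply/val_inj/word_mul0/(valP u). Qed.

Lemma fg_mulVg : left_inverse fg_one fg_inv fg_mul.
Proof. by move=> u; apply/val_inj/word_mulV. Qed.

Lemma fg_mulgV : right_inverse fg_one fg_inv fg_mul.
Proof.
by move=> u; apply/val_inj; rewrite /= -{1}[fg_word u]word_invK word_mulV.
Qed.

HB.instance Definition _ :=
  isGroup.Build free_group fg_mulA fg_mul1g fg_mulg1 fg_mulVg fg_mulgV.

End FreeGroup.

HB.instance Definition _ (S : countType) := [Countable of free_group S by <:].

Local Open Scope ring_scope.

(* The ring structure of {malg K[M]} in monalg requires a monoid M without
   nontrivial invertible elements, hence the alias and its own product. *)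
Definition group_algebra (K : nzRingType) (G : groupType) := {malg K[G]}.

Section GroupAlgebra.
Variables (K : nzRingType) (G : groupType).

HB.instance Definition _ := GRing.Lmodule.on (group_algebra K G).

Local Notation A := (group_algebra K G).
Implicit Types (a b c : A) (g h : G) (d e : {fset G}).
Local Open Scope fset_scope.

Definition ga_one : A := << (1%g : G) >>.

Definition ga_mul a b : A :=
  \sum_(g <- msupp a) \sum_(h <- msupp b) << a@_g * b@_h *g (g * h)%g >>.

Lemma ga_mulE d e a b : msupp a `<=` d -> msupp b `<=` e ->
  ga_mul a b = \sum_(g <- d) \sum_(h <- e) << a@_g * b@_h *g (g * h)%g >>.
Proof.
move=> le_d le_e; rewrite /ga_mul (big_fset_incl _ le_d) /=.
  apply/eq_bigr=> g _; apply/big_fset_incl => // h _ /mcoeff_outdom ->.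
  by rewrite mulr0 monalgU0.
move=> g _ /mcoeff_outdom ag0.
by rewrite big1 => // h _; rewrite ag0 mul0r monalgU0.
Qed.

Lemma ga_mul0g : left_zero 0 ga_mul.
Proof. by move=> b; rewrite /ga_mul msupp0 big_seq_fset0. Qed.

Lemma ga_mulg0 : right_zero 0 ga_mul.
Proof.
by move=> a; rewrite /ga_mul big1 // => g _; rewrite msupp0 big_seq_fset0.
Qed.

Lemma ga_mulDl : left_distributive ga_mul +%R.
Proof.
move=> a1 a2 b; set d := msupp a1 `|` msupp a2.
rewrite (@ga_mulE d (msupp b) (a1 + a2)%R) ?msuppD_le ?fsubset_refl //.
rewrite (@ga_mulE d (msupp b) a1) ?fsubsetUl ?fsubset_refl //.
rewrite (@ga_mulE d (msupp b) a2) ?fsubsetUr ?fsubset_refl //.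
rewrite -big_split /=; apply/eq_bigr => g _.
rewrite -big_split /=; apply/eq_bigr => h _.
by rewrite mcoeffD mulrDl monalgUD.
Qed.

Lemma ga_mulDr : right_distributive ga_mul +%R.
Proof.
move=> a b1 b2; set d := msupp b1 `|` msupp b2.
rewrite (@ga_mulE (msupp a) d _ (b1 + b2)%R) ?msuppD_le ?fsubset_refl //.
rewrite (@ga_mulE (msupp a) d _ b1) ?fsubsetUl ?fsubset_refl //.
rewrite (@ga_mulE (msupp a) d _ b2) ?fsubsetUr ?fsubset_refl //.
rewrite -big_split /=; apply/eq_bigr => g _.
rewrite -big_split /=; apply/eq_bigr => h _.
by rewrite mcoeffD mulrDr monalgUD.
Qed.

Lemma ga_mulUU (x y : K) g h :
  ga_mul << x *g g >> << y *g h >> = << x * y *g (g * h)%g >>.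
Proof.
by rewrite (ga_mulE msuppU_le msuppU_le) !big_seq_fset1 !mcoeffUU.
Qed.

Lemma ga_mul_suml (I : Type) (r : seq I) (F : I -> A) b :
  ga_mul (\sum_(i <- r) F i) b = \sum_(i <- r) ga_mul (F i) b.
Proof.
exact: (big_morph (ga_mul^~ b) (fun a1 a2 => ga_mulDl a1 a2 b) (ga_mul0g b)).
Qed.

Lemma ga_mul_sumr (I : Type) (r : seq I) (F : I -> A) a :
  ga_mul a (\sum_(i <- r) F i) = \sum_(i <- r) ga_mul a (F i).
Proof. exact: (big_morph (ga_mul a) (ga_mulDr a) (ga_mulg0 a)). Qed.

Lemma ga_mul1g : left_id ga_one ga_mul.
Proof.
move=> a; rewrite {1}[a]monalgE ga_mul_sumr [RHS]monalgE.
by apply/eq_bigr => g _; rewrite ga_mulUU mul1r mul1g.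
Qed.

Lemma ga_mulg1 : right_id ga_one ga_mul.
Proof.
move=> a; rewrite {1}[a]monalgE ga_mul_suml [RHS]monalgE.
by apply/eq_bigr => g _; rewrite ga_mulUU mulr1 mulg1.
Qed.

Lemma ga_mulA : associative ga_mul.
Proof.
move=> a b c; rewrite [a]monalgE.
elim/big_ind: _ => [|a1 a2 IH1 IH2|g _]; first by rewrite !ga_mul0g.
  by rewrite !ga_mulDl IH1 IH2.
rewrite [b]monalgE; elim/big_ind: _ => [|b1 b2 IH1 IH2|h _].
- by rewrite ga_mulg0 !ga_mul0g ga_mulg0.
- by rewrite ga_mulDl !ga_mulDr ga_mulDl IH1 IH2.
rewrite [c]monalgE; elim/big_ind: _ => [|c1 c2 IH1 IH2|k _].
- by rewrite !ga_mulg0.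
- by rewrite !ga_mulDr IH1 IH2.
by rewrite !ga_mulUU mulrA mulgA.
Qed.

Lemma ga_one_neq0 : ga_one != 0.
Proof. by rewrite monalgU_eq0 oner_eq0. Qed.

HB.instance Definition _ := GRing.Zmodule_isNzRing.Build (group_algebra K G)
  ga_mulA ga_mul1g ga_mulg1 ga_mulDl ga_mulDr ga_one_neq0.

Lemma ga_scaleAl (x : K) a b : x *: (a * b) = (x *: a) * b.
Proof.
have scaleE c : x *: c = ga_mul << x *g (1%g : G) >> c.
  rewrite [in RHS](monalgE c) ga_mul_sumr; apply/eq_bigr => g _.
  by rewrite ga_mulUU mul1g.
by rewrite !scaleE; apply: ga_mulA.
Qed.

HB.instance Definition _ :=
  GRing.Lmodule_isLalgebra.Build K (group_algebra K G) ga_scaleAl.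

End GroupAlgebra.

Section GroupAlgebraCom.
Variables (K : comNzRingType) (G : groupType).

Lemma ga_scaleAr (x : K) (a b : group_algebra K G) :
  x *: (a * b) = a * (x *: b).
Proof.
have scaleE c : x *: c = ga_mul c << x *g (1%g : G) >>.
  rewrite [in RHS](monalgE c) ga_mul_suml; apply/eq_bigr => g _.
  by rewrite ga_mulUU mulg1 mulrC.
by rewrite !scaleE; apply/esym/ga_mulA.
Qed.

HB.instance Definition _ :=
  GRing.Lalgebra_isAlgebra.Build K (group_algebra K G) ga_scaleAr.

End GroupAlgebraCom.

Local Open Scope classical_set_scope.

Definition right_ideal (A : pzRingType) (I : set A) : Prop :=
  [/\ I 0, forall a b, I a -> I b -> I (a + b) & forall a b, I a -> I (a * b)].

Section SchreierTransversals.
Variables (K : fieldType) (S : finType).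
Local Notation F := (free_group S).
Local Notation A := (group_algebra K F).
Implicit Types (T : set F) (I : set A) (R : rel F).

Definition Sp T : set A :=
  [set a | exists2 s : seq (K * F), (forall p, p \in s -> T p.2) &
             a = \sum_(p <- s) p.1 *: (<< p.2 >> : A)].

(* R is the reflexive relation, i.e. R u v stands for "u precedes or equals v". *)
Definition exposure_order R : Prop :=
  well_order R /\ forall u v : F, prefix u v -> R u v.

(* The strict relation on distinct subsets: min (B1 symdiff B2) lies in B1. *)
Definition prec_min R (B1 B2 : set F) : Prop :=
  exists2 m, minimum_of R [in B1 `+` B2] m & B1 m.

Definition prefix_closed T : Prop := forall u v : F, prefix u v -> T v -> T u.

Definition schreier_transversal I T : Prop :=
  [/\ prefix_closed T,
      Sp T `&` I = [set 0] &
      forall a : A, ([set a + i | i in I] `&` Sp T) !=set0].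

(* T is the minimum of the set of Schreier transversals for I with respect to
   prec_min R. *)
Definition minimal_schreier_transversal I R T : Prop :=
  schreier_transversal I T /\
  forall T', schreier_transversal I T' -> T' <> T -> prec_min R T T'.

Lemma minimal_schreier_transversal_uniq I R T T' : exposure_order R ->
  minimal_schreier_transversal I R T -> minimal_schreier_transversal I R T' ->
  T = T'.
Proof.
move=> [Rwo _] [schT minT] [schT' minT']; apply: contrapT => neqT.
have [m [Dm lbm] Tm] := minT T' schT' (fun e => neqT (esym e)).
have [n [Dn lbn] T'n] := minT' T schT neqT.
rewrite setYC in lbm; have Rmn := lbm n Dn.
rewrite setYC in lbn; have Rnm := lbn m Dm.
have woR : wo_chain R predT by move=> X _; apply: Rwo.
have emn : m = n by apply: (wo_chain_antisymmetric woR); rewrite ?Rmn.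
by move: Dm; rewrite -{}emn in T'n * => /set_mem[]; case.
Qed.

End SchreierTransversals.

(* Main.v *)
(* If T is contained in another transversal T', then each u in T' is congruent
   modulo I to some s in Sp T, so that u - s lies in Sp T' and in I; hence u = s
   and u is in T.  Thus distinct transversals are incomparable for inclusion, and
   an order which lists T first sees an element of T \ T' before any element of
   T' \ T.  Such an exposure order compares membership in T first (T is
   prefix-closed), then word length, then any fixed well-order. *)
Require Import Defs.
From mathcomp Require Import all_boot all_algebra.
From mathcomp.multinomials Require Import monalg.
From mathcomp Require Import boolp classical_sets wochoice.

Import GRing.Theory.

Lemma well_order_total (E : eqType) (R : rel E) : well_order R -> total R.
Proof.
move=> Rwo x y; have woR : wo_chain R predT by move=> X _; apply: Rwo.
exact: (wo_chainW woR).
Qed.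

Lemma well_order_anti (E : eqType) (R : rel E) : well_order R -> antisymmetric R.
Proof.
move=> Rwo x y; have woR : wo_chain R predT by move=> X _; apply: Rwo.
exact: (wo_chain_antisymmetric woR).
Qed.

Definition lex_rel {E : Type} (f : E -> nat) (R : rel E) : rel E :=
  fun u v => (f u < f v) || (f u == f v) && R u v.

(** Since [f] takes natural values, it attains a least value [k] on a nonempty [X]; the [R]-minimum
    of the fibre of [X] over [k] is then the minimum of [X]. *)
Lemma well_order_lex (E : eqType) (f : E -> nat) (R : rel E) :
  well_order R -> well_order (lex_rel f R).
Proof.
move=> Rwo; apply: antisymmetric_well_order => [x y | X [x0 Xx0]].
  rewrite /lex_rel; case: ltngtP => //= _ Rxy.
  exact: (well_order_anti _ _ Rwo).
have exk : exists k, `[< exists2 x, x \in X & f x = k >].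
  by exists (f x0); apply/asboolP; exists x0.
have [k /asboolP[x1 Xx1 fx1] min_k] := ex_minnP exk.
have [|z [[/andP[Xz /eqP fz] min_z] _]] := Rwo [pred x | (x \in X) && (f x == k)].
  by exists x1; rewrite inE Xx1 fx1 eqxx.
exists z; split=> // x Xx; rewrite /lex_rel fz.
have: k <= f x by apply: min_k; apply/asboolP; exists x.
rewrite leq_eqVlt => /orP[/eqP ek|->] //.
by rewrite -ek eqxx min_z ?orbT // inE Xx ek eqxx.
Qed.

Section SchreierTransversals.
Variables (K : fieldType) (S : finType).
Local Notation F := (free_group S).
Local Notation A := (group_algebra K F).
Implicit Types (T : set F) (I : set A) (R : rel F).
Local Open Scope ring_scope.
Local Open Scope classical_set_scope.

Lemma SpB T (a b : A) : Sp T a -> Sp T b -> Sp T (a - b).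
Proof.
move=> [s Ts ->] [t Tt ->]; exists (s ++ [seq (- p.1, p.2) | p <- t]).
  by move=> p; rewrite mem_cat => /orP[/Ts//|/mapP[q /Tt ? ->]].
rewrite big_cat big_map -sumrN; congr (_ + _).
by apply: eq_bigr => p _; rewrite scaleNr.
Qed.

Lemma SpS T T' : T `<=` T' -> (Sp T : set A) `<=` Sp T'.
Proof. by move=> sTT' a [s Ts ->]; exists s => // p /Ts /sTT'. Qed.

(** Compare coefficients at [u]: it is 1 in [<< u >>], but 0 in every combination of elements of [T]
    when [u] is outside [T]. *)
Lemma Sp_monomial T (u : F) : Sp T (<< u >> : A) <-> T u.
Proof.
split=> [[s Ts eu]|Tu]; last first.
  by exists [:: (1, u)]; [move=> p /[1!inE] /eqP-> | rewrite big_seq1 scale1r].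
apply: contrapT => nTu; have /eqP := congr1 (mcoeff u) eu.
rewrite mcoeffUU raddf_sum big_seq big1 ?oner_eq0 // => p /Ts Tp.
rewrite [LHS](mcoeffZ p.1 << p.2 >>) mcoeffU.
case: eqP => [ep|_]; last by rewrite mulr0.
by case: nTu; rewrite -ep.
Qed.

Lemma schreier_transversal_incl I T T' :
  schreier_transversal I T -> schreier_transversal I T' -> T `<=` T' -> T = T'.
Proof.
move=> [_ _ covT] [_ capT' _] sTT'; apply/seteqP; split=> // u T'u.
have [_ [[i Ii <-] Tui]] := covT << u >>.
(* [i] is the difference of [<< u >> + i], which lies in [Sp T], and [<< u >>]; both are in [Sp T'],
   which meets [I] only in 0. *)
have i0 : i = 0.
  suff: (Sp T' `&` I) i by rewrite capT'.
  split=> //; rewrite -[i](addKr << u >>) addrC.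
  by apply: SpB; [apply: SpS Tui | apply/Sp_monomial].
by move: Tui; rewrite i0 addr0 => /Sp_monomial.
Qed.

Lemma schreier_transversal_minimal I T R :
  schreier_transversal I T -> well_order R ->
  (forall u v : F, T u -> ~ T v -> R u v /\ u <> v) ->
  minimal_schreier_transversal I R T.
Proof.
move=> schT Rwo T_first; split=> // T' schT' neqT.
(* Without such a [u], [T] would be included in [T'], hence equal to it. *)
have [u Tu nT'u] : exists2 u, T u & ~ T' u.
  apply: contrapT => no_u; apply/neqT/esym.
  apply: (schreier_transversal_incl I) => // u Tu.
  by apply: contrapT => nT'u; apply: no_u; exists u.
have [|m [[Dm min_m] _]] := Rwo [in T `+` T'].
  by exists u; apply/mem_set; left.
exists m; first by [].
(* If [m] were in [T'] but not in [T], then [u] would strictly precede it, although [u] is in the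
   symmetric difference whose minimum is [m]. *)
have [[//]|[T'm nTm]] := set_mem Dm.
have [Rum neq_um] := T_first u m Tu nTm; case: neq_um.
apply: (well_order_anti _ _ Rwo); rewrite Rum min_m //.
by apply/mem_set; left.
Qed.

Lemma exposure_order_first T : prefix_closed T ->
  exists R, exposure_order R /\ forall u v : F, T u -> ~ T v -> R u v /\ u <> v.
Proof.
move=> preT; have [R0 R0wo] := well_ordering_principle F.
(* The negation gives members of [T] the key 0 and all other words the key 1. *)
exists (lex_rel (fun u : F => ~~ `[< T u >]) (lex_rel (fun u : F => size u) R0)).
split; last first.
  move=> u v Tu nTv; split; last by move=> euv; apply: nTv; rewrite -euv.
  by rewrite /lex_rel (asboolT Tu) (asboolF nTv).
split=> [|u v pre_uv]; first by do 2!apply: well_order_lex.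
(* A proper prefix is strictly shorter, so lengths tie only when [u = v]; there reflexivity of [R0]
   is needed, and it comes from totality. *)
have le_sz : lex_rel (fun u : F => size u) R0 u v.
  rewrite /lex_rel; case: ltngtP (size_prefix pre_uv) => //= esz _.
  have -> : u = v.
    by apply/val_inj/eqP; move: pre_uv; rewrite prefixE esz take_size eq_sym.
  by have := well_order_total _ _ R0wo v v; rewrite orbb.
(* It remains to see that the membership key never drops from a prefix to its extension, which is
   prefix-closedness of [T]. *)
rewrite {1}/lex_rel le_sz andbT.
case: asboolP => [_|nTu]; case: asboolP => // Tv.
by case: nTu; apply: preT Tv.
Qed.

End SchreierTransversals.

Theorem proposition3p12 (K : fieldType) (S : finType)
    (I : set (group_algebra K (free_group S))) (hI : right_ideal I) :
  (forall (T : set (free_group S)) (R : rel (free_group S)),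
     schreier_transversal I T ->
     exposure_order R ->
     (forall u v : free_group S, T u -> ~ T v -> R u v /\ u <> v) ->
     minimal_schreier_transversal I R T) /\
  (forall T : set (free_group S),
     schreier_transversal I T ->
     exists R : rel (free_group S),
       exposure_order R /\ minimal_schreier_transversal I R T).
Proof.
split=> [T R schT [Rwo _] | T schT]; first exact: schreier_transversal_minimal.
have [preT _ _] := schT.
have [R [expR T_first]] := exposure_order_first S T preT.
exists R; split=> //; have [Rwo _] := expR.
exact: schreier_transversal_minimal.
Qed.
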